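(* There exist absolute constants $\kappa>0$, $K>0$ and $N\ge 2$ such that for every integer $n\ge N$ the following hold. (1) For every integer $k\ge 1$ with $k<\kappa\,\dfrac{n^{1/6}}{\log n}$, we have $A_{n,k}^2\ge A_{n,k-1}A_{n,k+1}$. (2) For every integer $k>K\sqrt{n}\,\log n$, we have $A_{n,k}\ge A_{n,k+1}$.
   Context: For integers $n\ge 0$, the polynomials $Q_n(z)$ are defined by the identity of formal power series in $q$ $$\sum_{n=0}^\infty Q_n(z)q^n=\prod_{m=1}^\infty(1-q^m)^{-z-1}.$$ $Q_n(z)$ has degree $n$ and positive coefficients. $A_{n,k}$ denotes the coefficient of $z^k$ in $Q_n(z)$, with $A_{n,k}=0$ for undefined subscripts (e.g. $k>n$, $k<0$ or $n<0$). $\log$ is the natural logarithm. *)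

(* Defs.v *)
From HB Require Import structures.
From mathcomp Require Import all_boot all_order all_algebra.

Set Implicit Arguments.
Unset Strict Implicit.
Unset Printing Implicit Defensive.

Import Order.TTheory GRing.Theory Num.Theory.

Local Open Scope ring_scope.

Section FormalPowerSeries.
Variable A : comNzRingType.

(* A power series in q over A is its coefficient sequence. *)
Definition fps := nat -> A.

Definition fps_one : fps := fun n => (n == 0)%:R.

Definition fps_mul (f g : fps) : fps :=
  fun n => \sum_(i < n.+1) f i * g (n - i)%N.

(* F 1 * F 2 * ... * F M *)
Fixpoint fps_partial_prod (F : nat -> fps) (M : nat) : fps :=
  if M is M'.+1 then fps_mul (fps_partial_prod F M') (F M) else fps_one.

(* The infinite product of the F m, m >= 1, when F m = 1 + O(q^m): the
   coefficient of q^n is then unaffected by the factors with m > n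
   (fps_prod_stable below). *)
Definition fps_prod (F : nat -> fps) : fps := fun n => fps_partial_prod F n n.

Lemma fps_prod_stable (F : nat -> fps) :
    (forall m n, (0 < m)%N -> (n < m)%N -> F m n = fps_one n) ->
  forall n M, (n <= M)%N -> fps_partial_prod F M n = fps_prod F n.
Proof.
move=> F1 n; elim=> [|M IH]; first by rewrite leqn0 => /eqP->.
rewrite leq_eqVlt => /orP[/eqP-> // | nM]; rewrite -(IH nM) /= /fps_mul.
rewrite big_ord_recr /= subnn F1 // /fps_one mulr1 big1 ?add0r // => i _.
rewrite F1 ?(leq_ltn_trans (leq_subr _ _)) // /fps_one subn_eq0.
by rewrite leqNgt ltn_ord mulr0.
Qed.

End FormalPowerSeries.

Section NegativePower.
Variable R : numFieldType.
Implicit Types s : {poly R}.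

(* Coefficient of x^j in (1 - x)^(-s): s (s + 1) ... (s + j - 1) / j! *)
Definition negbinom s (j : nat) : {poly R} :=
  (j`!%:R : R)^-1 *: \prod_(i < j) (s + i%:R).

(* (1 - q^m)^(-s), for m >= 1 *)
Definition one_sub_qm_pow_neg s (m : nat) : fps {poly R} :=
  fun n => if (m %| n)%N then negbinom s (n %/ m) else 0.

Lemma negbinom0 s : negbinom s 0 = 1.
Proof. by rewrite /negbinom big_ord0 invr1 scale1r. Qed.

(* (1 - x) * (1 - x)^(-(s + 1)) = (1 - x)^(-s) *)
Lemma negbinomS s j :
  negbinom (s + 1) j.+1 - negbinom (s + 1) j = negbinom s j.+1.
Proof.
have shift k : \prod_(i < k) (s + 1 + i%:R) = \prod_(i < k) (s + i.+1%:R).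
  by apply: eq_bigr => i _; rewrite -addrA -[i.+1]add1n natrD.
have f0 k : (k`!%:R : R) != 0 by rewrite pnatr_eq0 -lt0n fact_gt0.
have j0 : (j.+1%:R : R) != 0 by rewrite pnatr_eq0.
have -> : negbinom (s + 1) j =
    (j.+1`!%:R : R)^-1 *: (j.+1%:R *: \prod_(i < j) (s + i.+1%:R)).
  by rewrite /negbinom shift scalerA factS natrM invfM mulrAC mulVf // mul1r.
rewrite /negbinom !shift -scalerBr; congr (_ *: _).
rewrite big_ord_recr big_ord_recl /= addr0 scaler_nat -[X in _ - X]mulr_natr -mulrBr.
by rewrite addrK mulrC.
Qed.

Lemma one_sub_qm_pow_neg_low s m n :
  (0 < m)%N -> (n < m)%N -> one_sub_qm_pow_neg s m n = fps_one _ n.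
Proof.
rewrite /one_sub_qm_pow_neg /fps_one => m0 nm.
case: n nm => [|n] nm; first by rewrite dvdn0 div0n negbinom0.
by rewrite gtnNdvd.
Qed.

End NegativePower.

(* \sum_n Q n * q^n = \prod_(m >= 1) (1 - q^m)^(- z - 1), with z := 'X *)
Definition Q (R : numFieldType) : fps {poly R} :=
  fps_prod (one_sub_qm_pow_neg ('X + 1)).

Lemma Q_stable (R : numFieldType) (n M : nat) : (n <= M)%N ->
  fps_partial_prod (one_sub_qm_pow_neg ('X + 1)) M n = Q R n.
Proof. by apply: fps_prod_stable => m k; apply: one_sub_qm_pow_neg_low. Qed.

(* Zero for k > n, since then k >= size (Q R n). *)
Definition coefA (R : numFieldType) (n k : nat) : R := (Q R n)`_k.

(* Main.v *)
Require Import Defs.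
From mathcomp Require Import all_boot all_order all_algebra.
From mathcomp Require Import all_classical all_reals all_analysis.
From mathcomp Require Import ring lra.

Set Implicit Arguments.
Unset Strict Implicit.
Unset Printing Implicit Defensive.

Import Order.TTheory GRing.Theory Num.Theory.

Local Open Scope ring_scope.

(** Let P(q) be the product of the (1 - q^m)^(-1) and let L(q) be the sum of
    the -log(1 - q^m), so that L has coefficients s(j) = sigma(j)/j, the sum of
    1/d over the divisors d of j.  The product defining the Q_n is P exp(z L),
    hence k! A_{n,k} is the coefficient a_k(n) of q^n in P L^k ([coefPL]).
    Differentiating in z and in q gives two convolution identities in n:
      a_{k+1} = s . a_k  and  n a_k = sigma . a_k + k sigma . a_{k-1}
    ([coefPLS], [euler_coefPL0], [euler_coefPLS]), and each a_k is
    nonnegative and nondecreasing in n ([coefPL_mono]).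

    Let S be partial summation and C = zeta(2).  The partial sums of s are
    C x + O(log x), so for f nonnegative and nondecreasing
      s . f = C S f + O(log n) f  and  sigma . f = C S S f + O(log n) S f
    ([abundancy_mul_approx], [sigma_mul_approx]).  With f = a_k, F = S f and
    G = S F, the second identity becomes n f = C G + O(k log n) F
    ([coefPL_moment]).  As F and f are the increments of G and F, this is a
    discrete Riccati recursion for G / F; its attracting solution is
    sqrt(n / C), and the ratio stays within O(k log n) of it ([psum_ratio]).
    Hence n f / F = sqrt(C n) + O(k log n), and
      a_{k+1}(n) / a_k(n) = C F / f + O(log n)
                          = sqrt(C n) (1 + O(k log n / sqrt n)).

    Log-concavity of A_{n,k} in k says that this ratio grows by a factor of at
    most (k + 1)/k from k - 1 to k.  It holds as soon as k^2 log n is at most a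
    small multiple of sqrt n ([coefA_log_concave]), in particular for k below a
    small multiple of n^(1/6) / log n.

    For the decrease at large k, F^2 <= 2 f G and G <= n f + F hold for every
    k and force F <= 3 sqrt n f ([psum_coefPL_le]); the coefficients s(j) with
    j <= n are at most 1 + log n, so a_{k+1} <= 6 sqrt n log n a_k for large n,
    whereas A_{n,k+1} <= A_{n,k} only asks for a_{k+1} <= (k + 1) a_k. *)

(** * Convolution of coefficient sequences *)

Section Convolution.
Variable A : comNzRingType.
Implicit Types (f g h : fps A) (n : nat).

(** Truncating to polynomials transfers the ring laws of [{poly A}] to [fps_mul]. *)
Lemma fps_mul_coef f g n N : (n < N)%N ->
  fps_mul f g n = (\poly_(i < N) f i * \poly_(i < N) g i)`_n.
Proof.
move=> nN; rewrite coefM; apply: eq_bigr => i _.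
by rewrite !coef_poly (leq_ltn_trans _ nN) ?leq_ord // (leq_ltn_trans (leq_subr _ _) nN).
Qed.

Lemma fps_mulC f g : fps_mul f g = fps_mul g f.
Proof.
by apply/funext => n; rewrite !(fps_mul_coef _ _ (ltnSn n)) mulrC.
Qed.

Lemma fps_mulA f g h : fps_mul f (fps_mul g h) = fps_mul (fps_mul f g) h.
Proof.
have coefP (u v w : fps A) n : fps_mul (fps_mul u v) w n =
    (\poly_(i < n.+1) u i * \poly_(i < n.+1) v i * \poly_(i < n.+1) w i)`_n.
  rewrite coefM; apply: eq_bigr => i _.
  rewrite (fps_mul_coef _ _ (ltn_ord i)) [X in _ = _ * X]coef_poly.
  by rewrite ltnS leq_subr.
apply/funext => n; rewrite fps_mulC !coefP; congr (_`_n); by rewrite mulrC mulrA.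
Qed.

Lemma fps_mulDl f g h :
  fps_mul (fun n => f n + g n) h = fun n => fps_mul f h n + fps_mul g h n.
Proof.
by apply/funext => n; rewrite -big_split /=; apply: eq_bigr => i _; rewrite mulrDl.
Qed.

Lemma fps_mulZl c f g :
  fps_mul (fun n => c * f n) g = fun n => c * fps_mul f g n.
Proof.
by apply/funext => n; rewrite /fps_mul mulr_sumr; apply: eq_bigr => i _; rewrite mulrA.
Qed.

Lemma scale_fps_mul c f g n :
  c * fps_mul f g n = fps_mul (fun m => c * f m) g n.
Proof. by rewrite fps_mulZl. Qed.

Lemma fps_mulZr c f g :
  fps_mul f (fun n => c * g n) = fun n => c * fps_mul f g n.
Proof. by rewrite fps_mulC fps_mulZl fps_mulC. Qed.

(** The derivation q d/dq on power series. *)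
Definition euler f : fps A := fun n => n%:R * f n.

Lemma euler_mul f g :
  euler (fps_mul f g) = fun n => fps_mul (euler f) g n + fps_mul f (euler g) n.
Proof.
apply/funext => n; rewrite /euler /fps_mul mulr_sumr -big_split /=.
apply: eq_bigr => i _; rewrite -{1}(subnKC (leq_ord i)) natrD; ring.
Qed.

(** Since b has no constant term, the coefficient n of the equation q f' = c + b f
    expresses n f(n) by the earlier coefficients of f. *)
Lemma fps_mul_unique (c b : fps A) f g : (forall n, (0 < n)%N -> GRing.rreg (n%:R : A)) ->
  b 0%N = 0 -> f 0%N = g 0%N ->
  (forall n, euler f n = c n + fps_mul b f n) ->
  (forall n, euler g n = c n + fps_mul b g n) -> f = g.
Proof.
move=> reg b0 fg0 Hf Hg; apply/funext => n.
elim/ltn_ind: n => -[//|n] IH; apply: (reg n.+1) => //.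
rewrite ![_ * n.+1%:R]mulrC.
move: (Hf n.+1) (Hg n.+1); rewrite /euler => -> ->; congr (_ + _).
rewrite /fps_mul big_ord_recl [in RHS]big_ord_recl /= b0 !mul0r; congr (_ + _).
by apply: eq_bigr => i _; rewrite IH // /bump /= add1n subSS ltnS leq_subr.
Qed.

End Convolution.

(** * The logarithmic q-derivative of the product *)

Section Divisors.
Variable A : comNzRingType.

(** The coefficients of m q^m / (1 - q^m), the logarithmic q-derivative of
    (1 - q^m)^(-1). *)
Definition dlog_factor (m : nat) : fps A :=
  fun j => if (0 < j)%N && (m %| j)%N then m%:R else 0.

Definition sigma : fps A := fun j => \sum_(1 <= m < j.+1) dlog_factor m j.

Lemma sigma_trunc (j M : nat) : (j <= M)%N ->
  \sum_(1 <= m < M.+1) dlog_factor m j = sigma j.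
Proof.
move=> jM; rewrite /sigma (@big_cat_nat _ _ _ j.+1 1 M.+1) //=.
rewrite [X in _ + X]big_nat_cond [X in _ + X]big1 ?addr0 // => m /andP[/andP[jm _] _].
by rewrite /dlog_factor; case: ifP => // /andP[j0 /(dvdn_leq j0)]; rewrite leqNgt jm.
Qed.

Lemma sigma0 : sigma 0 = 0.
Proof. by rewrite /sigma big_nil. Qed.
End Divisors.
Arguments sigma {A}.
Arguments dlog_factor {A}.

Section ProductIdentities.
Variable R : numFieldType.
Implicit Types s : {poly R}.

Lemma negbinom_rec s j :
  j.+1%:R * negbinom s j.+1 = (s + j%:R) * negbinom s j.
Proof.
have j0 : (j.+1%:R : R) != 0 by rewrite pnatr_eq0.
rewrite /negbinom big_ord_recr /= factS natrM invfM -scalerA mulrC -scalerAr.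
rewrite -[X in X = _]scalerAl mulr_natr -scaler_nat scalerA mulVf // scale1r.
by rewrite mulrC.
Qed.

(** Both sides obey the recursion n -> n - m: on the left because
    j nb(j) = (s + j - 1) nb(j - 1) for the binomial coefficients nb of the factor,
    on the right because [dlog_factor m] is m-periodic at positive indices. *)
Lemma euler_factor s m : (0 < m)%N ->
  euler (one_sub_qm_pow_neg s m) =
  fun n => s * fps_mul (dlog_factor m) (one_sub_qm_pow_neg s m) n.
Proof.
move=> m0; apply/funext; elim/ltn_ind => n IH.
set F := one_sub_qm_pow_neg s m in IH *.
case: (ltnP n m) => nm.
  rewrite /euler /F one_sub_qm_pow_neg_low // /fps_one /fps_mul big1 ?mulr0.
    by case: n nm {IH} => [|n] _; rewrite ?mul0r //= mulr0.
  move=> i _; rewrite /dlog_factor; case: ifP; rewrite ?mul0r // => /andP[i0 /(dvdn_leq i0)].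
  by rewrite leqNgt (leq_ltn_trans (leq_ord i) nm).
have nE : n = (m + (n - m))%N by rewrite subnKC.
set k := (n - m)%N in nE.
have kn : (k < n)%N by rewrite nE -[ltnLHS]add0n ltn_add2r.
have V : fps_mul (dlog_factor m) F n = fps_mul (dlog_factor m) F k + m%:R * F k.
  rewrite /fps_mul -(big_mkord xpredT (fun i => dlog_factor m i * F (n - i)%N)).
  rewrite (@big_cat_nat _ _ _ m) //=; last by rewrite ltnW.
  rewrite [X in X + _]big_nat_cond [X in X + _]big1 ?add0r; last first.
    move=> i /andP[/andP[_ im] _]; rewrite /dlog_factor.
    by case: ifP; rewrite ?mul0r // => /andP[i0 /(dvdn_leq i0)]; rewrite leqNgt im.
  rewrite -{1}[m]add0n big_addn subSn // -/k big_mkord.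
  rewrite big_ord_recl [in RHS]big_ord_recl /=.
  rewrite add0n -/k [dlog_factor m 0%N]/dlog_factor mul0r add0r.
  rewrite {1}/dlog_factor m0 dvdnn /= addrC.
  congr (_ + _); apply: eq_bigr => i _.
  rewrite /dlog_factor /bump /= !add1n addSn /= -addSn dvdn_addl //.
  by rewrite addnC subnDA.
rewrite V mulrDr -IH // /euler.
rewrite /F /one_sub_qm_pow_neg; rewrite {1 2}nE dvdn_addr //.
case: ifP => mk; last by rewrite !mulr0 addr0.
have -> : (n %/ m = (k %/ m).+1)%N by rewrite nE divnDl // divnn m0.
move: (negbinom_rec s (k %/ m)); set j := (k %/ m)%N => rec.
have -> : k = (j * m)%N by rewrite divnK.
rewrite -mulSn natrM mulrAC rec natrM; ring.
Qed.

Lemma euler_partial_prod s M :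
  euler (fps_partial_prod (one_sub_qm_pow_neg s) M) =
  fun n => s * fps_mul (fun j => \sum_(1 <= m < M.+1) dlog_factor m j)
                       (fps_partial_prod (one_sub_qm_pow_neg s) M) n.
Proof.
elim: M => [|M IH] /=.
  apply/funext => -[|n]; rewrite /euler /fps_one ?mul0r ?mulr0.
    by rewrite /fps_mul big1 ?mulr0 // => i _; rewrite big_nil mul0r.
  by rewrite /fps_mul big1 ?mulr0 // => i _; rewrite big_nil mul0r.
rewrite euler_mul IH euler_factor // fps_mulZl fps_mulZr.
apply/funext => n; rewrite -mulrDr; congr (_ * _).
set P := fps_partial_prod _ M; set F := one_sub_qm_pow_neg _ _.
rewrite (_ : (fun j => \sum_(1 <= m < M.+2) _) =
  fun j => \sum_(1 <= m < M.+1) dlog_factor m j + dlog_factor M.+1 j); last first.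
  by apply/funext => j; rewrite big_nat_recr.
by rewrite fps_mulDl !fps_mulA [fps_mul P (dlog_factor _)]fps_mulC.
Qed.

Lemma euler_Q : euler (Q R) = fun n => ('X + 1) * fps_mul sigma (Q R) n.
Proof.
apply/funext => n; have := congr1 (fun f => f n) (euler_partial_prod ('X + 1 : {poly R}) n).
rewrite /euler Q_stable // => ->; congr (_ * _).
apply: eq_bigr => i _; rewrite sigma_trunc ?leq_ord //.
by rewrite Q_stable ?leq_subr.
Qed.

End ProductIdentities.

(** * The coefficients of P L^k *)

Section Coefficients.
Variable R : numFieldType.

(** The coefficients of L, that is, of the sum over m of -log(1 - q^m).  The value at
    0 is 0, because division by 0 gives 0. *)
Definition abundancy : fps R := fun j => sigma j / j%:R.

Lemma euler_abundancy : euler abundancy = sigma.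
Proof.
apply/funext => -[|j]; first by rewrite /euler mul0r sigma0.
by rewrite /euler /abundancy mulrC divfK // pnatr_eq0.
Qed.

Lemma sigmaC j : sigma j = (sigma j : R)%:P.
Proof.
rewrite /sigma rmorph_sum; apply: eq_bigr => m _; rewrite /dlog_factor /=.
by case: ifP => _; rewrite ?polyC0 // polyC_natr.
Qed.

(** The derivative of P exp(z L) in z is L P exp(z L).  Both sides satisfy the equation
    q d/dq G = sigma . Q + (z + 1) sigma . G, which has one solution with G(0) = 0. *)
Lemma deriv_Q : (fun n => (Q R n)^`()) = fps_mul (fun j => (abundancy j)%:P) (Q R).
Proof.
set sP := (X in fps_mul X _).
have euler_sP : euler sP = sigma.
  by apply/funext => j; rewrite sigmaC -euler_abundancy /euler polyCM polyC_natr.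
apply: (@fps_mul_unique _ (fps_mul sigma (Q R)) (fun j => ('X + 1) * sigma j)).
- by move=> n n0; apply: mulIf; rewrite -polyC_natr polyC_eq0 pnatr_eq0 -lt0n.
- by rewrite sigma0 mulr0.
- rewrite /Q /fps_prod /= /fps_one derivC /fps_mul big1 // => i _.
  by rewrite ord1 /sP /abundancy sigma0 mul0r polyC0 mul0r.
- move=> n; have eQ : n%:R * Q R n = ('X + 1) * fps_mul sigma (Q R) n.
    by rewrite -[LHS]/(euler (Q R) n) euler_Q.
  rewrite /euler mulr_natl -derivMn -mulr_natl eQ.
  rewrite derivM derivD derivX derivC addr0 mul1r fps_mulZl; congr (_ + _ * _).
  rewrite /fps_mul raddf_sum; apply: eq_bigr => i _.
  by rewrite sigmaC /= derivM derivC mul0r add0r.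
move=> n; rewrite euler_mul euler_sP euler_Q fps_mulZr fps_mulZl; congr (_ + _ * _).
by rewrite !fps_mulA [fps_mul sP _]fps_mulC.
Qed.

(** The coefficient of q^n in P L^k. *)
Definition coefPL (k : nat) : fps R := fun n => k`!%:R * coefA R n k.

Lemma coefPLS k : coefPL k.+1 = fps_mul abundancy (coefPL k).
Proof.
apply/funext => n; have dQ : (Q R n)^`() = fps_mul (fun j => (abundancy j)%:P) (Q R) n.
  by rewrite -deriv_Q.
rewrite /coefPL /coefA factS mulnC natrM -mulrA [k.+1%:R * _]mulr_natl -coef_deriv dQ.
rewrite /fps_mul coef_sum mulr_sumr; apply: eq_bigr => i _.
by rewrite coefCM mulrCA.
Qed.

Lemma coef_fps_mul_sigma n k :
  (fps_mul sigma (Q R) n)`_k = fps_mul sigma (fun m => coefA R m k) n.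
Proof.
by rewrite /fps_mul coef_sum; apply: eq_bigr => i _; rewrite sigmaC coefCM.
Qed.

Lemma euler_coefQ n k : n%:R * coefA R n k = (fps_mul sigma (Q R) n)`_k +
  (if k is k'.+1 then (fps_mul sigma (Q R) n)`_k' else 0).
Proof.
have eQ : n%:R * Q R n = ('X + 1) * fps_mul sigma (Q R) n.
  by rewrite -[LHS]/(euler (Q R) n) euler_Q.
rewrite /coefA -coefCM polyC_natr eQ mulrDl mul1r coefD coefXM.
by rewrite addrC; case: k.
Qed.

Lemma euler_coefPL0 : euler (coefPL 0) = fps_mul sigma (coefPL 0).
Proof.
apply/funext => n; rewrite /euler mulrCA euler_coefQ addr0 coef_fps_mul_sigma.
by rewrite /coefPL fps_mulZr.
Qed.

Lemma euler_coefPLS k : euler (coefPL k.+1) =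
  fun n => fps_mul sigma (coefPL k.+1) n + k.+1%:R * fps_mul sigma (coefPL k) n.
Proof.
apply/funext => n; rewrite /euler mulrCA euler_coefQ !coef_fps_mul_sigma.
by rewrite /coefPL !fps_mulZr mulrDr factS natrM mulrA.
Qed.

Definition nneg_poly (p : {poly R}) := forall k, 0 <= p`_k.

Lemma nneg_polyD p q : nneg_poly p -> nneg_poly q -> nneg_poly (p + q).
Proof. by move=> p0 q0 k; rewrite coefD addr_ge0. Qed.

Lemma nneg_polyM p q : nneg_poly p -> nneg_poly q -> nneg_poly (p * q).
Proof. by move=> p0 q0 k; rewrite coefM sumr_ge0 // => i _; rewrite mulr_ge0. Qed.

Lemma nneg_poly_nat m : nneg_poly m%:R.
Proof. by move=> k; rewrite -polyC_natr coefC; case: ifP. Qed.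

Lemma nneg_polyX : nneg_poly 'X.
Proof. by move=> k; rewrite coefX. Qed.

Lemma fps_mul_nneg (f g : fps {poly R}) :
  (forall n, nneg_poly (f n)) -> (forall n, nneg_poly (g n)) ->
  forall n, nneg_poly (fps_mul f g n).
Proof.
move=> f0 g0 n; rewrite /fps_mul; elim/big_ind: _ => [|p q|i _].
- exact: (nneg_poly_nat 0).
- exact: nneg_polyD.
exact: nneg_polyM.
Qed.

Lemma factor_nneg (s : {poly R}) m n :
  nneg_poly s -> nneg_poly (one_sub_qm_pow_neg s m n).
Proof.
move=> s0; rewrite /one_sub_qm_pow_neg; case: ifP => _; last exact: (nneg_poly_nat 0).
move=> k; rewrite coefZ mulr_ge0 ?invr_ge0 //; move: k.
rewrite -/(nneg_poly _); elim/big_ind: _ => [|p q|i _].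
- exact: (nneg_poly_nat 1).
- exact: nneg_polyM.
by apply: nneg_polyD => //; apply: nneg_poly_nat.
Qed.

Lemma factor_X1_nneg m n : nneg_poly (one_sub_qm_pow_neg ('X + 1) m n).
Proof.
by apply: factor_nneg; apply: nneg_polyD; [exact: nneg_polyX | exact: (nneg_poly_nat 1)].
Qed.

(** The shape of this factorization, (1 - q)^(-z-1) = (1 - q)^(-1) (1 - q)^(-z), makes
    Q_n the sequence of partial sums of polynomials with nonnegative coefficients. *)
Lemma first_factor_ones :
  one_sub_qm_pow_neg ('X + 1 : {poly R}) 1 = fps_mul (fun=> 1) (one_sub_qm_pow_neg 'X 1).
Proof.
apply/funext => n; rewrite fps_mulC /fps_mul /one_sub_qm_pow_neg dvd1n divn1.
under eq_bigr do rewrite dvd1n divn1 mulr1.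
elim: n => [|n IH]; first by rewrite big_ord1 !negbinom0.
by rewrite big_ord_recr /= -IH -(negbinomS 'X) addrC subrK.
Qed.

Lemma partial_prod_ones M : exists2 g : fps {poly R},
  (forall n, nneg_poly (g n)) &
  fps_partial_prod (one_sub_qm_pow_neg ('X + 1)) M.+1 = fps_mul (fun=> 1) g.
Proof.
elim: M => [|M [g g0 IH]].
  exists (one_sub_qm_pow_neg 'X 1); first by move=> n; apply: factor_nneg nneg_polyX.
  rewrite /= first_factor_ones; apply/funext => n.
  rewrite /fps_mul big_ord_recl /fps_one /= subn0 mul1r.
  by rewrite [X in _ + X]big1 ?addr0 // => i _; rewrite mul0r.
exists (fps_mul g (one_sub_qm_pow_neg ('X + 1) M.+2)).
  by apply: fps_mul_nneg => // n; apply: factor_X1_nneg.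
by rewrite -[LHS]/(fps_mul (fps_partial_prod _ M.+1) _) IH fps_mulA.
Qed.

Lemma fps_mul1_recr (A : comNzRingType) (f : fps A) n :
  fps_mul (fun=> 1) f n.+1 = fps_mul (fun=> 1) f n + f n.+1.
Proof.
rewrite fps_mulC /fps_mul big_ord_recr /= mulr1.
by congr (_ + _); apply: eq_bigr => i _; rewrite !mulr1.
Qed.

Lemma coefPL_mono k n : coefPL k n <= coefPL k n.+1.
Proof.
have [g g0 gE] := partial_prod_ones n.
rewrite ler_pM2l ?ltr0n ?fact_gt0 // /coefA.
rewrite -(@Q_stable _ n n.+1) // -(@Q_stable _ n.+1 n.+1) // gE fps_mul1_recr coefD.
by rewrite lerDl g0.
Qed.

Lemma coefPL_ge0 k n : 0 <= coefPL k n.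
Proof.
rewrite mulr_ge0 // /coefA -(Q_stable _ (leqnn n)); move: k.
suff pos M m : nneg_poly (fps_partial_prod (one_sub_qm_pow_neg ('X + 1)) M m).
  exact: pos.
elim: M m => [|M IH] m; first exact: nneg_poly_nat.
by apply: fps_mul_nneg => // j; apply: factor_X1_nneg.
Qed.

End Coefficients.

(** * Partial summation *)

Section Estimates.
Variable R : realType.
Implicit Types (f g : fps R) (n x j d : nat).

Definition psum (f : fps R) : fps R := fps_mul (fun=> 1) f.

Lemma psum0 f : psum f 0 = f 0%N.
Proof. by rewrite /psum /fps_mul big_ord1 mul1r. Qed.

Lemma psumS f n : psum f n.+1 = psum f n + f n.+1.
Proof. exact: fps_mul1_recr. Qed.

Lemma psum_ge0 f n : (forall i, 0 <= f i) -> 0 <= psum f n.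
Proof. by move=> f0; apply: sumr_ge0 => i _; rewrite mul1r. Qed.

Lemma psum_one n : psum (fun=> 1) n = n.+1%:R.
Proof. by elim: n => [|n IH]; rewrite ?psum0 // psumS IH natr1. Qed.

Lemma psum_natS n : psum (fun i => i.+1%:R) n = n.+1%:R * n.+2%:R / 2.
Proof.
elim: n => [|n IH]; first by rewrite psum0 mul1r divff // pnatr_eq0.
by rewrite psumS IH -!natr1; field.
Qed.

Lemma psum_diff f : f = psum (fun n => if n is m.+1 then f n - f m else f 0%N).
Proof.
apply/funext; elim=> [|n IH]; first by rewrite psum0.
by rewrite psumS -IH addrC subrK.
Qed.

Lemma fps_mul_le (a b : fps R) g n : (forall j, (j <= n)%N -> a j <= b j) ->
  (forall j, 0 <= g j) -> fps_mul a g n <= fps_mul b g n.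
Proof. by move=> ab g0; apply: ler_sum => i _; rewrite ler_wpM2r ?ab ?leq_ord. Qed.

(** Applied to partial sums a, b and to the increments g of a monotone sequence, this
    is Abel summation. *)
Lemma fps_mul_close (a b c : fps R) g n :
  (forall j, (j <= n)%N -> `|a j - b j| <= c j) -> (forall j, 0 <= g j) ->
  `|fps_mul a g n - fps_mul b g n| <= fps_mul c g n.
Proof.
move=> abc g0; rewrite -sumrB; apply: (le_trans (ler_norm_sum _ _ _)).
apply: ler_sum => i _; rewrite -mulrBl normrM (ger0_norm (g0 _)).
by rewrite ler_wpM2r ?abc ?leq_ord.
Qed.

(** * Harmonic numbers and zeta(2) *)

Definition harmonic_sum n : R := \sum_(1 <= d < n.+1) d%:R^-1.

Definition basel_sum n : R := \sum_(1 <= d < n.+1) d%:R ^- 2.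

Definition zeta2 : R := sup (range basel_sum).

Lemma harmonic_sumS n : harmonic_sum n.+1 = harmonic_sum n + n.+1%:R^-1.
Proof. by rewrite /harmonic_sum big_nat_recr. Qed.

Lemma harmonic_sum_mono m n : (m <= n)%N -> harmonic_sum m <= harmonic_sum n.
Proof.
move=> /subnK <-; elim: (n - m)%N => [|k IH]; first by rewrite add0n.
by rewrite addSn harmonic_sumS (le_trans IH) // lerDl invr_ge0.
Qed.

Lemma harmonic_sum_ge0 n : 0 <= harmonic_sum n.
Proof. by apply: sumr_ge0 => i _; rewrite invr_ge0. Qed.

(** From ln (1 - 1/(n+1)) <= - 1/(n+1). *)
Lemma harmonic_sum_le_ln n : (0 < n)%N -> harmonic_sum n <= 1 + ln n%:R.
Proof.
case: n => // n _; elim: n => [|n IH].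
  by rewrite harmonic_sumS /harmonic_sum big_nil add0r invr1 ln1 addr0.
rewrite harmonic_sumS; have n0 : (0 : R) < n.+2%:R by rewrite ltr0n.
have n1 : (0 : R) < n.+1%:R by rewrite ltr0n.
have i1 : n.+2%:R^-1 < 1 :> R by rewrite invf_lt1 // ltr1n.
have : ln (1 + - n.+2%:R^-1) <= - n.+2%:R^-1 :> R.
  by apply: le_ln1Dx; rewrite ltrN2.
have -> : 1 + - n.+2%:R^-1 = n.+1%:R / n.+2%:R :> R.
  by rewrite -[n.+2%:R]natr1; field.
rewrite ln_div ?posrE //; move: IH; set a := ln _; set b := ln _; set c := _^-1; lra.
Qed.

Lemma baselS n : basel_sum n.+1 = basel_sum n + n.+1%:R ^- 2.
Proof. by rewrite /basel_sum big_nat_recr. Qed.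

Lemma basel_mono m n : (m <= n)%N -> basel_sum m <= basel_sum n.
Proof.
move=> /subnK <-; elim: (n - m)%N => [|k IH]; first by rewrite add0n.
by rewrite addSn baselS (le_trans IH) // lerDl invr_ge0 exprn_ge0.
Qed.

(** The sequence basel_sum m + 1/m is nonincreasing, as 1/(m+1)^2 <= 1/m - 1/(m+1). *)
Lemma basel_tail m n : (0 < m)%N -> basel_sum n <= basel_sum m + m%:R^-1.
Proof.
move=> m0; case: (leqP n m) => [nm|/ltnW/subnK <-].
  by rewrite (le_trans (basel_mono nm)) // lerDl invr_ge0.
suff step k : basel_sum (k + m) + (k + m)%:R^-1 <= basel_sum m + m%:R^-1.
  by rewrite (le_trans _ (step (n - m)%N)) // lerDl invr_ge0.
elim: k => [//|k]; apply: le_trans; rewrite addSn baselS.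
set p := (k + m)%N; have p0 : (0 : R) < p%:R by rewrite ltr0n addn_gt0 m0 orbT.
rewrite -addrA lerD2l -natr1.
have q0 : 0 < p%:R + 1 :> R by rewrite addr_gt0.
rewrite -subr_ge0.
have -> : p%:R^-1 - ((p%:R + 1) ^- 2 + (p%:R + 1)^-1) =
   (p%:R * (p%:R + 1) ^+ 2)^-1 :> R by field; rewrite !gt_eqF.
by rewrite invr_ge0 mulr_ge0 ?exprn_ge0 ?ltW.
Qed.

Lemma basel_le_zeta2 n : basel_sum n <= zeta2.
Proof.
apply: ub_le_sup; last by exists n.
by exists (basel_sum 1 + 1%:R^-1) => _ [m _ <-]; apply: basel_tail.
Qed.

Lemma zeta2_le_basel m : (0 < m)%N -> zeta2 <= basel_sum m + m%:R^-1.
Proof.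
move=> m0; apply: ge_sup; first by exists (basel_sum 0); exists 0%N.
by move=> _ [n _ <-]; apply: basel_tail.
Qed.

Lemma basel1 : basel_sum 1 = 1.
Proof. by rewrite baselS /basel_sum big_nil add0r expr1n invr1. Qed.

Lemma zeta2_ge1 : 1 <= zeta2.
Proof. by rewrite -basel1 basel_le_zeta2. Qed.

Lemma zeta2_le2 : zeta2 <= 2.
Proof. by have := zeta2_le_basel (ltn0Sn 0); rewrite basel1 invr1. Qed.

(** * Mean values of the divisor sums *)

(** Counting the pairs (m, d) with m d = j by their first component; used for both
    components to exchange m and j / m in sums over divisors. *)
Lemma sum_cofactor (F : nat -> R) m j : (0 < m)%N -> (0 < j)%N ->
  \sum_(1 <= d < j.+1) (if (m * d == j)%N then F d else 0) =
  if (m %| j)%N then F (j %/ m)%N else 0.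
Proof.
move=> m0 j0; case: ifP => [mj|Nmj]; last first.
  rewrite big_nat_cond big1 // => d _; case: eqP => // jE.
  by rewrite -jE dvdn_mulr in Nmj.
rewrite (bigD1_seq (j %/ m)%N) ?iota_uniq //=; last first.
  by rewrite mem_index_iota divn_gt0 // dvdn_leq //= ltnS leq_div.
rewrite mulnC divnK // eqxx big1 ?addr0 // => d dj.
case: eqP => // jE; move: dj; rewrite -jE mulKn // eqxx //.
Qed.

Lemma abundancyE j : (0 < j)%N ->
  abundancy R j = \sum_(1 <= d < j.+1) (if (d %| j)%N then d%:R^-1 else 0).
Proof.
move=> j0; rewrite /abundancy /sigma mulr_suml.
have jn0 : (j%:R : R) != 0 by rewrite pnatr_eq0 -lt0n.
transitivity (\sum_(1 <= m < j.+1) \sum_(1 <= d < j.+1)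
    (if (m * d == j)%N then d%:R^-1 else 0 : R)).
  apply: eq_big_nat => m /andP[m0 _]; rewrite sum_cofactor // /dlog_factor j0 /=.
  case: ifP => mj; last by rewrite mul0r.
  have mn0 : (m%:R : R) != 0 by rewrite pnatr_eq0 -lt0n.
  have q0 : ((j %/ m)%:R : R) != 0 by rewrite pnatr_eq0 -lt0n divn_gt0 // dvdn_leq.
  by rewrite -{1}(divnK mj) natrM; field; rewrite mn0 q0.
rewrite exchange_big; apply: eq_big_nat => d /andP[d0 _].
under eq_bigr do rewrite mulnC.
exact: (@sum_cofactor (fun=> d%:R^-1)).
Qed.

Lemma abundancy0 : abundancy R 0 = 0.
Proof. by rewrite /abundancy sigma0 mul0r. Qed.

Lemma abundancy_ge0 j : 0 <= abundancy R j.
Proof.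
case: j => [|j]; first by rewrite abundancy0.
by rewrite abundancyE // sumr_ge0 // => d _; case: ifP; rewrite ?invr_ge0.
Qed.

Lemma abundancy_ge1 j : (0 < j)%N -> 1 <= abundancy R j.
Proof.
move=> j0; rewrite abundancyE // big_ltn // dvd1n invr1 lerDl sumr_ge0 // => d _.
by case: ifP; rewrite ?invr_ge0.
Qed.

Lemma abundancy_le_harmonic_sum j : abundancy R j <= harmonic_sum j.
Proof.
case: j => [|j]; first by rewrite abundancy0 harmonic_sum_ge0.
rewrite abundancyE //; apply: ler_sum => d _.
by case: ifP; rewrite ?invr_ge0.
Qed.

Lemma sigmaE j : sigma j = j%:R * abundancy R j.
Proof. by rewrite -[RHS]/(euler (abundancy R) j) euler_abundancy. Qed.

(** Among 1, ..., x there are x %/ d multiples of d. *)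
Lemma psum_abundancy x :
  psum (abundancy R) x = \sum_(1 <= d < x.+1) d%:R^-1 * (x %/ d)%:R.
Proof.
have -> : psum (abundancy R) x = \sum_(1 <= j < x.+1) abundancy R j.
  elim: x => [|x IH]; first by rewrite psum0 abundancy0 big_nil.
  by rewrite psumS IH [RHS]big_nat_recr.
transitivity (\sum_(1 <= j < x.+1) \sum_(1 <= d < x.+1)
    (if (d %| j)%N then d%:R^-1 else 0 : R)).
  apply: eq_big_nat => j /andP[j0 jx]; rewrite abundancyE //.
  rewrite (@big_cat_nat _ _ _ j.+1 1 x.+1) //= -[LHS]addr0; congr (_ + _).
  rewrite big_nat_cond big1 // => d /andP[/andP[jd _] _].
  by case: ifP => // /(dvdn_leq j0); rewrite leqNgt jd.
rewrite exchange_big; apply: eq_big_nat => d _.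
rewrite divn_count_dvd natr_sum mulr_sumr; apply: eq_bigr => j _.
by case: ifP; rewrite ?mulr1 ?mulr0.
Qed.

Lemma psum_abundancy_le x : psum (abundancy R) x <= zeta2 * x%:R.
Proof.
rewrite psum_abundancy; apply: (@le_trans _ _ (basel_sum x * x%:R)).
  rewrite mulr_suml; apply: ler_sum_nat => d /andP[d0 _].
  have dp : (0 : R) < d%:R by rewrite ltr0n.
  rewrite -exprVn expr2 -mulrA ler_wpM2l ?invr_ge0 //.
  by rewrite mulrC ler_pdivlMr // -natrM ler_nat leq_trunc_div.
by rewrite ler_wpM2r ?basel_le_zeta2.
Qed.

Lemma psum_abundancy_ge x :
  zeta2 * x%:R - (1 + harmonic_sum x) <= psum (abundancy R) x.
Proof.
case: x => [|x]; first by rewrite mulr0 psum0 abundancy0 sub0r oppr_le0;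
  rewrite addr_ge0 ?harmonic_sum_ge0.
set y := x.+1; rewrite psum_abundancy.
apply: (@le_trans _ _ (basel_sum y * y%:R - harmonic_sum y)).
  have yp : (0 : R) < y%:R by rewrite ltr0n.
  have := zeta2_le_basel (ltn0Sn x); rewrite -/y -(ler_pM2r yp) mulrDl mulVf ?gt_eqF //.
  lra.
rewrite mulr_suml -sumrB; apply: ler_sum_nat => d /andP[d0 _].
have dp : (0 : R) < d%:R by rewrite ltr0n.
rewrite -exprVn expr2 -mulrA -[X in _ - X]mulr1 -mulrBr ler_wpM2l ?invr_ge0 //.
rewrite lerBlDr mulrC ler_pdivrMr // natr1 -natrM ler_nat ltnW //.
exact: ltn_ceil.
Qed.

Lemma psum_abundancy_ge_id x : x%:R <= psum (abundancy R) x.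
Proof.
elim: x => [|x IH]; first by rewrite psum0 abundancy0.
by rewrite psumS -natr1 lerD // abundancy_ge1.
Qed.

(** Abel summation for sigma(j) = j s(j). *)
Lemma psum_sigma_abel x :
  psum sigma x + psum (psum (abundancy R)) x = x.+1%:R * psum (abundancy R) x.
Proof.
elim: x => [|x IH]; first by rewrite !psum0 sigma0 abundancy0 mulr0 addr0.
rewrite [psum sigma _]psumS [psum (psum _) _]psumS sigmaE.
rewrite addrACA IH psumS -[x.+2%:R]natr1; ring.
Qed.

(** One error term serves both mean values below; zeta2 absorbs the shift from x to
    x + 1 in their main terms, and 1 the tail of the series of zeta(2). *)
Definition err n : R := 1 + zeta2 + harmonic_sum n.

Lemma err_mono m n : (m <= n)%N -> err m <= err n.
Proof. by move=> mn; rewrite lerD2l harmonic_sum_mono. Qed.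

Lemma psum_abundancy_approx n x : (x <= n)%N ->
  `|psum (abundancy R) x - zeta2 * x.+1%:R| <= err n.
Proof.
move=> xn; have := psum_abundancy_le x; have := psum_abundancy_ge x.
have := harmonic_sum_mono xn; have := zeta2_ge1; have := harmonic_sum_ge0 x.
rewrite ler_norml /err -natr1; nra.
Qed.

Lemma psum_sigma_approx n x : (x <= n)%N ->
  `|psum sigma x - zeta2 * psum (fun i => i.+1%:R) x| <= err n * x.+1%:R.
Proof.
move=> xn; have := psum_sigma_abel x; rewrite psum_natS.
have hx := harmonic_sum_mono xn; have h0 := harmonic_sum_ge0 x; have z1 := zeta2_ge1.
have PL : psum (psum (abundancy R)) x <= zeta2 * x%:R * x.+1%:R / 2.
  elim: {xn hx h0} x => [|x IH]; first by rewrite !psum0 abundancy0; lra.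
  rewrite psumS; have := psum_abundancy_le x.+1.
  move: IH; rewrite -[x.+2%:R]natr1 -[x.+1%:R]natr1; lra.
have PG : zeta2 * x%:R * x.+1%:R / 2 - x.+1%:R * (1 + harmonic_sum x) <=
    psum (psum (abundancy R)) x.
  have aux y : (y <= x)%N ->
    zeta2 * y%:R * y.+1%:R / 2 - y.+1%:R * (1 + harmonic_sum x) <= psum (psum (abundancy R)) y.
    elim: y => [|y IH] yx; first by rewrite !psum0 abundancy0; lra.
    rewrite psumS; have := psum_abundancy_ge y.+1; have := IH (ltnW yx).
    have := harmonic_sum_mono yx; rewrite -[y.+2%:R]natr1 -[y.+1%:R]natr1; nra.
  exact: aux.
have := psum_abundancy_le x; have := psum_abundancy_ge x.
rewrite -(ler_pM2l (ltr0Sn R x)) => AG; rewrite -(ler_pM2l (ltr0Sn R x)) => AL.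
have EX : (1 + harmonic_sum x) * x.+1%:R <= (1 + harmonic_sum n) * x.+1%:R.
  by rewrite ler_wpM2r // lerD2l.
move=> E; rewrite ler_norml /err; move: AG AL PL PG EX E;
rewrite -[x.+2%:R]natr1 -[x.+1%:R]natr1; nra.
Qed.

End Estimates.

(** * Convolution with s and sigma against partial summation *)

Section Convolved.
Variable R : realType.
Implicit Types (f g : fps R) (n k : nat).
Local Notation err := (err R).
Local Notation zeta2 := (zeta2 R).
Local Notation abundancy := (abundancy R).

Definition nneg_mono f := 0 <= f 0%N /\ forall n, f n <= f n.+1.

Lemma nneg_mono_psum f : nneg_mono f ->
  exists2 g : fps R, (forall n, 0 <= g n) & f = psum g.
Proof.
move=> [f0 fS]; eexists; last exact: psum_diff.
by case=> [|n] //; rewrite subr_ge0.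
Qed.

Lemma fps_mul_psum (a : fps R) g : fps_mul a (psum g) = fps_mul (psum a) g.
Proof. by rewrite /psum !fps_mulA [fps_mul a _]fps_mulC. Qed.

(** Writing f = S g moves the summation from f to the coefficients s, whose partial
    sums are close to zeta(2) (x + 1); here g >= 0 keeps the error under control. *)
Lemma abundancy_mul_approx f n : nneg_mono f ->
  `|fps_mul abundancy f n - zeta2 * psum f n| <= err n * f n.
Proof.
move=> /nneg_mono_psum[g g0 ->].
rewrite fps_mul_psum [psum (psum g)]fps_mul_psum !scale_fps_mul.
apply: fps_mul_close => // j jn.
by rewrite psum_one mulr1 psum_abundancy_approx.
Qed.

Lemma sigma_mul_approx f n : nneg_mono f ->
  `|fps_mul sigma f n - zeta2 * psum (psum f) n| <= err n * psum f n.
Proof.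
move=> /nneg_mono_psum[g g0 ->].
rewrite fps_mul_psum; rewrite [psum (psum g)]fps_mul_psum [psum (fps_mul _ _)]fps_mulA.
rewrite -/(psum (psum (fun=> 1))) (_ : psum (fun=> 1) = fun i => i.+1%:R); last first.
  by apply/funext => i; rewrite psum_one.
rewrite !scale_fps_mul.
by apply: fps_mul_close => // j jn; apply: psum_sigma_approx.
Qed.

(** Termwise, from sigma(j) = j s(j), s(j) <= err n and j <= s(1) + ... + s(j).  This
    bounds the term k sigma . a_{k-1} by a multiple of S a_k. *)
Lemma sigma_mul_le (e : fps R) n : (forall m, 0 <= e m) ->
  fps_mul sigma e n <= err n * psum (fps_mul abundancy e) n.
Proof.
move=> e0; rewrite [psum _]fps_mulA -/(psum abundancy).
rewrite scale_fps_mul.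
apply: fps_mul_le => // j jn; rewrite sigmaE mulrC.
have zH : harmonic_sum R j <= err n.
  by rewrite (le_trans (harmonic_sum_mono R jn)) // lerDr addr_ge0 //
    (le_trans ler01 (zeta2_ge1 R)).
apply: ler_pM => //; first exact: abundancy_ge0.
  exact: le_trans (abundancy_le_harmonic_sum _ _) zH.
exact: psum_abundancy_ge_id.
Qed.

(** * A discrete Riccati recursion *)

(** With F = S f and G = S F, write Y(n) = sqrt(n / c) and B = 2 / c.  If G(n) > X F(n)
    with X = Y(n) + B lam(n), then n f = c G + O(lam) F forces F(n) <= X f(n), so that
    G(n-1) = G(n) - F(n) > X (F(n) - f(n)) = X F(n-1): the upper bound has already failed
    at n - 1.  The lower bound is symmetric, up to the
    drift Y(n) - Y(n-1), which is at most Y(n) / n.  All inequalities are kept free of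
    divisions, as f and F may vanish at small n. *)
Section Riccati.
Variables (c : R) (lam : nat -> R) (f : fps R).
Hypothesis c0 : 0 < c.
Hypothesis lam1 : forall n, 1 <= lam n.
Hypothesis lamc : forall n, c <= 2 * lam n.
Hypothesis lam_mono : forall n, lam n <= lam n.+1.
Hypothesis f0 : forall n, 0 <= f n.
Hypothesis moment : forall n,
  `|n%:R * f n - c * psum (psum f) n| <= lam n * psum f n.

Let F := psum f.
Let G := psum F.
Let Y n : R := Num.sqrt (n%:R / c).
Let B : R := 2 / c.

Let c_ge0 : 0 <= c. Proof. exact: ltW. Qed.

Let Y_ge0 n : 0 <= Y n. Proof. exact: sqrtr_ge0. Qed.

Let Y_sqr n : c * Y n ^+ 2 = n%:R.
Proof. by rewrite sqr_sqrtr ?divr_ge0 // mulrC divfK ?gt_eqF. Qed.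

Let F_ge0 n : 0 <= F n. Proof. exact: psum_ge0. Qed.

Let cB : c * B = 2. Proof. by rewrite mulrC divfK ?gt_eqF. Qed.

Let lam_ge0 n : 0 <= lam n. Proof. exact: le_trans ler01 (lam1 n). Qed.

Let Blam_ge0 n : 0 <= B * lam n.
Proof. by rewrite mulr_ge0 ?divr_ge0. Qed.

Let Y_mono n : Y n <= Y n.+1.
Proof. by rewrite ler_wsqrtr // ler_wpM2r ?invr_ge0 // ler_nat. Qed.

(* The drift Y(n+1) - Y(n) is at most Y(n+1) / (n+1). *)
Let Y_step n : n.+1%:R * Y n.+1 - Y n.+1 <= n.+1%:R * Y n.
Proof.
have := Y_sqr n; have := Y_sqr n.+1; have := Y_ge0 n; have := Y_ge0 n.+1.
rewrite -natr1; have n0 : (0 : R) <= n%:R by [].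
move: (Y n.+1) (Y n) (n%:R : R) n0 => y x m m0 y0 x0 Ey Ex.
have cn : c != 0 by rewrite gt_eqF.
have -> : (m + 1) * y - y = m * y by ring.
rewrite -(@ler_pXn2r _ 2) // ?nnegrE ?mulr_ge0 ?addr_ge0 //.
rewrite !exprMn -(ler_pM2l c0).
have -> : c * (m ^+ 2 * y ^+ 2) = m ^+ 2 * (m + 1) by rewrite mulrCA Ey.
have -> : c * ((m + 1) ^+ 2 * x ^+ 2) = (m + 1) ^+ 2 * m by rewrite mulrCA Ex.
have : 0 <= m * m by rewrite mulr_ge0.
by nra.
Qed.

Let upper n : G n <= (Y n + B * lam n) * F n.
Proof.
elim: n => [|n IH].
  rewrite /G psum0 -[leLHS]mul1r ler_wpM2r // /Y mul0r sqrtr0 add0r.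
  by rewrite /B mulrAC ler_pdivlMr // mul1r.
rewrite leNgt; apply/negP => lt.
set X := Y n.+1 + B * lam n.+1 in lt *.
have X0 : 0 <= X by rewrite addr_ge0.
have IH' : G n <= X * F n.
  by rewrite (le_trans IH) // ler_wpM2r // lerD // ler_wpM2l // divr_ge0 //.
have GS : G n.+1 = G n + F n.+1 by exact: psumS.
have FS : F n.+1 = F n + f n.+1 by exact: psumS.
have mom : c * G n.+1 - lam n.+1 * F n.+1 <= n.+1%:R * f n.+1.
  by have /ler_normlP[] := moment n.+1; rewrite -/F -/G; lra.
have mf : (c * X - lam n.+1) * F n.+1 <= n.+1%:R * f n.+1.
  apply: le_trans mom; rewrite mulrBl lerD2r -mulrA ler_pM2l //; exact: ltW.
(* With the bound on f / F just obtained, this gives F <= X f. *)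
have quad : n.+1%:R <= X * (c * X - lam n.+1).
  have -> : X * (c * X - lam n.+1) = c * Y n.+1 ^+ 2 + (2 * (c * B) - 1) * lam n.+1 * Y n.+1
     + (c * B - 1) * lam n.+1 * (B * lam n.+1) by rewrite /X; ring.
  rewrite Y_sqr cB -addrA lerDl addr_ge0 // mulr_ge0 // ?mulr_ge0 //; lra.
have mp : (0 : R) < n.+1%:R by rewrite ltr0n.
have : n.+1%:R * F n.+1 <= n.+1%:R * (X * f n.+1).
  apply: (@le_trans _ _ (X * (c * X - lam n.+1) * F n.+1)); first by rewrite ler_wpM2r.
  by rewrite -mulrA [leRHS]mulrCA ler_wpM2l.
rewrite ler_pM2l // => Ff.
by move: lt; rewrite GS; have := IH'; nra.
Qed.

Let lower n : (Y n - B * lam n) * F n <= G n.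
Proof.
have G0 m : 0 <= G m by apply: psum_ge0.
elim: n => [|n IH].
  rewrite (le_trans _ (G0 0%N)) // mulr_le0_ge0 // /Y mul0r sqrtr0 sub0r oppr_le0 //.
set X := Y n.+1 - B * lam n.+1.
case: (leP X 0) => [X0|X0]; first by rewrite (le_trans _ (G0 _)) // mulr_le0_ge0.
rewrite leNgt; apply/negP => lt.
set d := Y n.+1 - Y n.
have IH' : (X - d) * F n <= G n.
  apply: le_trans IH; rewrite ler_wpM2r // /X /d.
  have : B * lam n <= B * lam n.+1 by rewrite ler_wpM2l // divr_ge0 //.
  lra.
have GS : G n.+1 = G n + F n.+1 by exact: psumS.
have FS : F n.+1 = F n + f n.+1 by exact: psumS.
have mom : n.+1%:R * f n.+1 <= c * G n.+1 + lam n.+1 * F n.+1.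
  by have /ler_normlP[] := moment n.+1; rewrite -/F -/G; lra.
have mf : n.+1%:R * f n.+1 <= (c * X + lam n.+1) * F n.+1.
  apply: (le_trans mom); rewrite mulrDl lerD2r -mulrA ler_pM2l //; exact: ltW.
have d0 : 0 <= d by rewrite subr_ge0 Y_mono.
have mp : (0 : R) < n.+1%:R by rewrite ltr0n.
have l1 := lam1 n.+1.
have quad : X * (c * X + lam n.+1) <= n.+1%:R * (1 - d).
  have E : c * X + lam n.+1 = c * Y n.+1 - lam n.+1.
    by rewrite /X mulrBr mulrA cB; ring.
  have P : 0 < c * X + lam n.+1 by rewrite addr_gt0 ?mulr_gt0 // (lt_le_trans ltr01).
  apply: (@le_trans _ _ (Y n.+1 * (c * Y n.+1 - lam n.+1))).
    by rewrite -E ler_wpM2r ?gerBl // ltW.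
  have := Y_step n; have := Y_sqr n.+1; have := Y_ge0 n.+1; rewrite /d; nra.
have : n.+1%:R * (X * f n.+1) <= n.+1%:R * ((1 - d) * F n.+1).
  apply: (@le_trans _ _ (X * (c * X + lam n.+1) * F n.+1)).
    by rewrite mulrCA -mulrA ler_wpM2l // ltW.
  by rewrite mulrA ler_wpM2r.
rewrite ler_pM2l // => Ff.
have df : 0 <= d * f n.+1 by rewrite mulr_ge0.
by move: lt; rewrite GS; have := IH'; nra.
Qed.

(** The hypothesis n f = c G + O(lam) F, with G replaced by (sqrt(n / c) + O(lam)) F. *)
Lemma psum_ratio n :
  `|n%:R * f n - Num.sqrt (c * n%:R) * psum f n| <= 3 * lam n * psum f n.
Proof.
have -> : Num.sqrt (c * n%:R) = c * Y n.
  have -> : c * n%:R = c ^+ 2 * (n%:R / c) by field; rewrite gt_eqF.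
  by rewrite sqrtrM ?sqr_ge0 // sqrtr_sqr gtr0_norm.
have /ler_normlP[m1 m2] := moment n; rewrite -/F -/G in m1 m2 *.
have := upper n; rewrite -(ler_pM2l c0) => u.
have := lower n; rewrite -(ler_pM2l c0) => l.
have E1 : c * ((Y n + B * lam n) * F n) = (c * Y n + (c * B) * lam n) * F n by ring.
have E2 : c * ((Y n - B * lam n) * F n) = (c * Y n - (c * B) * lam n) * F n by ring.
rewrite E1 cB in u; rewrite E2 cB in l.
rewrite ler_norml; apply/andP; split; lra.
Qed.

End Riccati.

(** The discrete form of F^2 = 2 int f F <= 2 f int F: from n to n + 1 the left side
    grows by 2 f F - f^2 and the right side by at least 2 f F, with f and F taken at
    n + 1. *)
Lemma psum_sqr_le f n : nneg_mono f -> (psum f n) ^+ 2 <= 2 * f n * psum (psum f) n.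
Proof.
move=> [f0 fS]; have fp m : 0 <= f m by elim: m => // m IH; apply: le_trans (fS m).
have G0 m : 0 <= psum (psum f) m by apply: psum_ge0 => i; apply: psum_ge0.
elim: n => [|n IH]; first by rewrite !psum0; have := sqr_ge0 (f 0%N); lra.
rewrite [psum (psum f) _]psumS psumS.
have fG : f n * psum (psum f) n <= f n.+1 * psum (psum f) n by rewrite ler_wpM2r.
have alg (a b d e : R) : a ^+ 2 <= 2 * d * e -> d * e <= b * e ->
    0 <= b ^+ 2 -> (a + b) ^+ 2 <= 2 * b * (e + (a + b)) by lra.
exact: alg IH fG (sqr_ge0 _).
Qed.

End Convolved.

(** * Consecutive ratios of the coefficients of P L^k *)

Section CoefPLBounds.
Variable R : realType.
Implicit Types (n k : nat).
Local Notation err := (err R).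
Local Notation zeta2 := (zeta2 R).
Local Notation coefPL := (coefPL R).

Lemma coefPL_nneg_mono k : nneg_mono (coefPL k).
Proof. by split; [exact: coefPL_ge0 | exact: coefPL_mono]. Qed.

Lemma zeta2_gt0 : 0 < zeta2.
Proof. exact: lt_le_trans ltr01 (zeta2_ge1 R). Qed.

Lemma err_ge n : 1 + zeta2 <= err n.
Proof. by rewrite lerDl harmonic_sum_ge0. Qed.

Lemma psum_coefPL_ge0 k n : 0 <= psum (coefPL k) n.
Proof. by apply: psum_ge0 => i; apply: coefPL_ge0. Qed.

(** The identity n a_k = sigma . a_k + k sigma . a_{k-1}, with the first convolution
    replaced by zeta(2) S S a_k and the second treated as an error. *)
Lemma coefPL_moment k n :
  `|n%:R * coefPL k n - zeta2 * psum (psum (coefPL k)) n| <=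
  k.+1%:R * err n * psum (coefPL k) n.
Proof.
have sig := sigma_mul_approx n (coefPL_nneg_mono k).
case: k sig => [|k] sig.
  rewrite mul1r; apply: le_trans sig.
  by rewrite -[n%:R * _]/(euler (coefPL 0) n) euler_coefPL0.
rewrite -[n%:R * _]/(euler (coefPL k.+1) n) euler_coefPLS.
have D0 : 0 <= fps_mul sigma (coefPL k) n.
  apply: sumr_ge0 => i _; rewrite mulr_ge0 ?coefPL_ge0 // sigmaE.
  by rewrite mulr_ge0 ?abundancy_ge0.
have := sigma_mul_le n (coefPL_ge0 R k); rewrite -coefPLS -(ler_pM2l (ltr0Sn R k)) => D1.
rewrite addrAC; apply: (le_trans (ler_normD _ _)).
rewrite (ger0_norm (mulr_ge0 _ D0)) //.
by rewrite -[k.+2%:R]natr1 [k.+1%:R + 1]addrC !mulrDl mul1r -mulrA lerD.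
Qed.

Lemma coefPL_psum_ratio k n :
  `|n%:R * coefPL k n - Num.sqrt (zeta2 * n%:R) * psum (coefPL k) n| <=
  3 * (k.+1%:R * err n) * psum (coefPL k) n.
Proof.
have z0 := zeta2_gt0; have k1 : 1 <= k.+1%:R :> R by rewrite ler1n.
have lamE m : 1 + zeta2 <= k.+1%:R * err m.
  have e0 := err_ge m; rewrite (le_trans e0) // ler_peMl //; lra.
apply: (psum_ratio (lam := fun m => k.+1%:R * err m)) => // m.
- have := lamE m; lra.
- have := lamE m; lra.
- by rewrite ler_wpM2l // err_mono.
- exact: coefPL_ge0.
exact: coefPL_moment.
Qed.

(** With Z = sqrt(zeta(2) n) and lam = (j + 2) err n, one has
    a_{j+2} <= (Z + 7 lam) a_{j+1} and a_{j+1} >= (Z - 4 lam) a_j, and the hypothesis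
    gives (j + 1) (Z + 7 lam) <= (j + 2) (Z - 4 lam). *)
Lemma coefPL_log_concave j n :
  15 * j.+2%:R ^+ 2 * err n <= Num.sqrt (zeta2 * n%:R) ->
  j.+1%:R * (coefPL j n * coefPL j.+2 n) <= j.+2%:R * coefPL j.+1 n ^+ 2.
Proof.
set Z := Num.sqrt _ => large.
have Z2 : Z ^+ 2 = zeta2 * n%:R by rewrite sqr_sqrtr // mulr_ge0 // ltW // zeta2_gt0.
have z0 := zeta2_gt0; have e1 := err_ge n.
set lam := j.+2%:R * err n.
have j1 : j.+1%:R + 1 = j.+2%:R :> R by rewrite natr1.
have j0 : 0 <= j%:R :> R by [].
have j1' : j%:R + 1 = j.+1%:R :> R by rewrite natr1.
have err_lam : err n <= lam by rewrite ler_peMl // ?ler1n //; lra.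
have lam_large : 15 * j.+2%:R * lam <= Z by rewrite mulrA -[_ * _ * j.+2%:R]mulrA -expr2.
have lam_pos : 0 < lam by lra.
have lam30 : 30 * lam <= Z.
  apply: le_trans lam_large; rewrite ler_pM2r //; lra.
have /ler_normlP[A1 _] := coefPL_psum_ratio j.+1 n; rewrite -/Z -/lam in A1.
have /ler_normlP[_ A2] := coefPL_psum_ratio j n; rewrite -/Z in A2.
have /ler_normlP[_ B1] := abundancy_mul_approx n (coefPL_nneg_mono j.+1).
have /ler_normlP[B2 _] := abundancy_mul_approx n (coefPL_nneg_mono j).
rewrite -coefPLS in B1; rewrite -coefPLS in B2.
have F0 := psum_coefPL_ge0 j.+1 n; have E0 := psum_coefPL_ge0 j n.
have g0 := coefPL_ge0 R j.+2 n.
have f0 := coefPL_ge0 R j.+1 n; have e0 := coefPL_ge0 R j n.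
move: (psum (coefPL j.+1) n) (psum (coefPL j) n) (coefPL j.+2 n) (coefPL j.+1 n) (coefPL j n)
  F0 E0 g0 f0 e0 A1 A2 B1 B2 => F E g f e F0 E0 g0 f0 e0 A1 A2 B1 B2.
have {}A1 : (Z - 3 * lam) * F <= n%:R * f by lra.
have {}A2 : n%:R * e <= (Z + 3 * lam) * E.
  have : j.+1%:R * err n * E <= lam * E.
    by rewrite ler_wpM2r // ler_wpM2r ?ler_nat //; lra.
  lra.
have U : zeta2 * F <= (Z + 6 * lam) * f.
  rewrite -(@ler_pM2l _ (Z - 3 * lam)); last by lra.
  apply: (@le_trans _ _ (Z ^+ 2 * f)).
    by rewrite Z2 mulrCA -mulrA ler_pM2l.
  rewrite mulrA ler_wpM2r //.
  have : 0 <= lam * (Z - 6 * lam) by rewrite mulr_ge0 //; lra.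
  lra.
have V : (Z - 3 * lam) * e <= zeta2 * E.
  rewrite -(@ler_pM2l _ (Z + 3 * lam)); last by lra.
  apply: (@le_trans _ _ (Z ^+ 2 * e)).
    rewrite mulrA ler_wpM2r //; have := sqr_ge0 lam; lra.
  by rewrite Z2 mulrCA -mulrA ler_pM2l.
have U' : g <= (Z + 7 * lam) * f.
  have : err n * f <= lam * f by rewrite ler_wpM2r.
  lra.
have V' : (Z - 4 * lam) * e <= f.
  have : err n * e <= lam * e by rewrite ler_wpM2r.
  lra.
apply: (@le_trans _ _ (j.+1%:R * (Z + 7 * lam) * (e * f))).
  rewrite -mulrA ler_pM2l ?ltr0n // [leRHS]mulrCA ler_wpM2l //.
apply: (@le_trans _ _ (j.+2%:R * (Z - 4 * lam) * (e * f))).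
  rewrite ler_wpM2r ?mulr_ge0 // -j1 -j1'.
  move: lam_large; rewrite -j1 -j1'.
  have : 0 <= j%:R * lam by rewrite mulr_ge0 // ltW.
  lra.
by rewrite -mulrA ler_pM2l ?ltr0n // mulrA expr2 ler_wpM2r.
Qed.

(** Otherwise f <= s f < F / 3, and 2 f (s^2 f + F) < (2/9 + 2/3) F^2. *)
Lemma le_of_sqr_bound (s G F f : R) : 1 <= s -> 0 <= F -> 0 <= f ->
  F ^+ 2 <= 2 * f * G -> G <= s ^+ 2 * f + F -> F <= 3 * s * f.
Proof.
move=> s1 F0 f0 sqF moment.
rewrite leNgt; apply/negP => lt.
have sf : 0 <= s * f by rewrite mulr_ge0 //; lra.
have Fp : 0 < F by apply: le_lt_trans lt; lra.
have h1 : f * G <= f * (s ^+ 2 * f + F) by rewrite ler_wpM2l.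
have sF : s * f <= F / 3 by lra.
have h2 : (s * f) ^+ 2 <= (F / 3) ^+ 2 by rewrite lerXn2r ?nnegrE // (le_trans sf).
have h3 : f * F <= F / 3 * F.
  rewrite ler_wpM2r //; have : f <= s * f by rewrite ler_peMl.
  lra.
have h4 : 0 < F ^+ 2 by rewrite exprn_gt0.
lra.
Qed.

(** Here sigma(j) >= j suffices: n a_k is at least the sum of the j a_k(n - j), which
    is G - F. *)
Lemma psum_coefPL_le k n : (0 < n)%N ->
  psum (coefPL k) n <= 3 * Num.sqrt n%:R * coefPL k n.
Proof.
move=> n0; have := psum_sqr_le n (coefPL_nneg_mono k).
have moment : psum (psum (coefPL k)) n <= n%:R * coefPL k n + psum (coefPL k) n.
  rewrite {1}/psum fps_mulA -/(psum (fun=> 1)) -lerBlDr.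
  rewrite (_ : psum (fun=> 1) = fun i => i.+1%:R); last first.
    by apply/funext => i; rewrite psum_one.
  apply: (@le_trans _ _ (fps_mul sigma (coefPL k) n)).
    rewrite /psum /fps_mul -sumrB; apply: ler_sum => i _.
    rewrite -mulrBl ler_wpM2r ?coefPL_ge0 //.
    rewrite -natr1 addrK sigmaE; case: (nat_of_ord i) => [|m]; first by rewrite mul0r.
    by rewrite ler_peMr // abundancy_ge1.
  rewrite -[n%:R * _]/(euler (coefPL k) n).
  case: k => [|k]; first by rewrite euler_coefPL0.
  rewrite euler_coefPLS lerDl mulr_ge0 // sumr_ge0 // => i _.
  by rewrite mulr_ge0 ?coefPL_ge0 // sigmaE mulr_ge0 ?abundancy_ge0.
have s1 : 1 <= Num.sqrt n%:R :> R by rewrite -[leLHS]sqrtr1 ler_wsqrtr // ler1n.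
have s2 : Num.sqrt n%:R ^+ 2 = n%:R :> R by rewrite sqr_sqrtr.
have F0 := psum_coefPL_ge0 k n; have f0 := coefPL_ge0 R k n.
by rewrite -s2 in moment => sq; exact: le_of_sqr_bound sq moment.
Qed.

Lemma coefPLS_le k n : (0 < n)%N ->
  coefPL k.+1 n <= 3 * Num.sqrt n%:R * harmonic_sum R n * coefPL k n.
Proof.
move=> n0; rewrite coefPLS.
apply: (@le_trans _ _ (harmonic_sum R n * psum (coefPL k) n)).
  rewrite /psum scale_fps_mul; apply: fps_mul_le => [j jn|j]; last exact: coefPL_ge0.
  by rewrite mulr1; exact: le_trans (abundancy_le_harmonic_sum _ _) (harmonic_sum_mono _ jn).
rewrite mulrAC mulrC ler_wpM2r ?harmonic_sum_ge0 //; exact: psum_coefPL_le.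
Qed.

Lemma coefA_log_concave j n :
  15 * j.+2%:R ^+ 2 * err n <= Num.sqrt (zeta2 * n%:R) ->
  coefA R n j * coefA R n j.+2 <= coefA R n j.+1 ^+ 2.
Proof.
move=> /coefPL_log_concave concave.
set c : R := j.+2%:R * j.+1`!%:R ^+ 2.
have c0 : 0 < c by apply: mulr_gt0; [|apply: exprn_gt0]; rewrite ltr0n ?fact_gt0.
rewrite -(ler_pM2l c0).
have -> : c * coefA R n j.+1 ^+ 2 = j.+2%:R * coefPL j.+1 n ^+ 2.
  by rewrite /coefPL exprMn [RHS]mulrA.
have -> : c * (coefA R n j * coefA R n j.+2) =
    j.+1%:R * (coefPL j n * coefPL j.+2 n).
  by rewrite /c /coefPL [j.+2`!]factS (factS j) !natrM; ring.
exact: concave.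
Qed.

Lemma coefA_decreasing k n : (0 < n)%N ->
  3 * Num.sqrt n%:R * harmonic_sum R n <= k.+1%:R -> coefA R n k.+1 <= coefA R n k.
Proof.
move=> n0 large; have a0 := coefPL_ge0 R k n.
have := le_trans (coefPLS_le k n0) (ler_wpM2r a0 large).
by rewrite /coefPL factS natrM -mulrA ler_pM2l ?ltr0n // ler_pM2l ?ltr0n ?fact_gt0.
Qed.

End CoefPLBounds.

Theorem theorem1p1 (R : realType) :
  exists (kappa K : R) (N : nat),
    [/\ 0 < kappa, 0 < K, (2 <= N)%N &
      forall n : nat, (N <= n)%N ->
        (forall k : nat, (1 <= k)%N ->
           k%:R < kappa * ((n%:R `^ (1 / 6)) / ln n%:R) ->
           coefA R n (k - 1) * coefA R n (k + 1) <= coefA R n k ^+ 2) /\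
        (forall k : nat,
           K * Num.sqrt n%:R * ln n%:R < k%:R ->
           coefA R n (k + 1) <= coefA R n k)].
Proof.
(* The choice of N makes ln n >= 1, so that err n <= 4 + ln n <= 5 ln n and the harmonic
   number is at most 2 ln n.  Then K = 3 * 2, and kappa has to satisfy
   15 * 2^2 * 5 * kappa^2 <= 1, the factor 2 coming from k + 1 <= 2 k. *)
exists (1 / 100), 6, (Num.bound (expR 1 : R)).+2; split=> // n Nn.
have n0 : (0 < n)%N by apply: leq_trans Nn.
have np : (0 : R) < n%:R by rewrite ltr0n.
have n1 : (1 : R) <= n%:R by rewrite ler1n.
have L1 : 1 <= ln n%:R :> R.
  rewrite -[leLHS]expRK ler_ln ?posrE ?expR_gt0 //.
  apply: ltW (lt_le_trans (archi_boundP (expR_ge0 _)) _).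
  by rewrite ler_nat (leq_trans _ Nn) // -addn2 leq_addr.
have H := harmonic_sum_le_ln R n0.
split=> k.
  case: k => // j _; rewrite subn1 addn1 /= => kn; apply: coefA_log_concave.
  set x := n%:R `^ (1 / 6) in kn.
  rewrite mulrA ltr_pdivlMr ?(lt_le_trans ltr01 L1) // in kn.
  have x1 : 1 <= x by rewrite -(powRr0 n%:R) ler_powR.
  have x6 : x ^+ 6 = n%:R.
    by rewrite -powR_mulrn ?powR_ge0 // -powRrM divfK ?pnatr_eq0 // powRr1.
  have xZ : x ^+ 2 <= Num.sqrt (zeta2 R * n%:R).
    apply: (@le_trans _ _ (Num.sqrt n%:R)); last first.
      by rewrite ler_wsqrtr // ler_peMl // zeta2_ge1.
    rewrite -x6 -[6%N]/(3 * 2)%N exprM sqrtr_sqr ger0_norm ?exprn_ge0 //; last lra.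
    by rewrite ler_weXn2l.
  have E : err R n <= 5 * ln n%:R by rewrite /err; have := zeta2_le2 R; lra.
  apply: le_trans xZ.
  have k1 : 1 <= j.+1%:R :> R by rewrite ler1n.
  have k2 : j.+2%:R <= 2 * j.+1%:R :> R by rewrite -[j.+2%:R]natr1; lra.
  move: (ln _) L1 H E kn => L L1 H E kx.
  move: k1 k2 kx; move: (j.+1%:R : R) (j.+2%:R : R) (ler0n R j.+2) => k k' k'0 k1 k2 kx.
  have E0 : 0 <= err R n by have := err_ge R n; have := zeta2_ge1 R; lra.
  have h1 : k' ^+ 2 <= 4 * k ^+ 2.
    have -> : 4 * k ^+ 2 = (2 * k) ^+ 2 by ring.
    by rewrite ler_sqr ?nnegrE //; lra.
  have h2 : (k * L) ^+ 2 <= (x / 100) ^+ 2.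
    by rewrite ler_sqr ?nnegrE ?mulr_ge0 //; lra.
  have h3 : k' ^+ 2 * err R n <= 4 * k ^+ 2 * (5 * L).
    by apply: ler_pM => //; rewrite sqr_ge0.
  have h4 : k ^+ 2 * L <= (k * L) ^+ 2.
    rewrite exprMn ler_wpM2l ?sqr_ge0 // expr2 ler_peMl //; lra.
  have := sqr_ge0 x; lra.
rewrite addn1 => kn; apply: coefA_decreasing => //.
have s0 : 0 <= Num.sqrt n%:R :> R by apply: sqrtr_ge0.
have : Num.sqrt n%:R * harmonic_sum R n <= Num.sqrt n%:R * (2 * ln n%:R).
  by rewrite ler_wpM2l //; lra.
rewrite -natr1; lra.
Qed.
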